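(* Fix $n \ge 1$ and $x>0$ with $nx^2 \le 1$. Then for any finite $G\subset\mathbb{T}$: (strong FKG inequality) for any $\tau \in \{-1,1\}^{\mathbb{T}}$ and any two increasing events $A$ and $B$, \[ \mu_{G,n,x}^\tau(A\cap B)\ge\mu_{G,n,x}^\tau(A) \cdot \mu_{G,n,x}^\tau(B); \] (comparison between boundary conditions) for any $\tau\le\tau'$ in $\{-1,1\}^{\mathbb{T}}$ and any increasing event $A$, \[ \mu_{G,n,x}^\tau(A)\le \mu_{G,n,x}^{\tau'}(A). \]
   Context: $\mathbb{T}$ is the triangular lattice with vertices $r+e^{i\pi/3}s$, $r,s\in\mathbb{Z}$ (nearest neighbours at distance 1). For $\tau\in\{-1,1\}^{\mathbb{T}}$ and $G\subset\mathbb{T}$ finite, $\Sigma(G,\tau)\subset\{-1,1\}^{\mathbb{T}}$ is the set of spin configurations that coincide with $\tau$ outside $G$. For $n,x>0$, $\mu_{G,n,x}^\tau$ is the probability measure on $\Sigma(G,\tau)$ defined by \[ \mu_{G,n,x}^\tau(\sigma)=\frac{n^{k(\sigma)}x^{e(\sigma)}}{\mathbf{Z}_{G,n,x}^\tau}, \] where $k(\sigma)+1$ is the sum of the number of connected components of pluses and of minuses in $\sigma$ (connectivity in $\mathbb{T}$) that intersect $G$ or its neighborhood (the set of vertices adjacent to $G$), $e(\sigma)=\sum_{u\sim v}\mathbf{1}_{\sigma_u\ne\sigma_v}$ is the number of edges $\{u,v\}$ of $\mathbb{T}$ that intersect $G$ and have $\sigma_u\neq\sigma_v$, and $\mathbf{Z}_{G,n,x}^\tau$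 is the normalizing constant. The partial order on $\{-1,1\}^{\mathbb{T}}$ is: $\tau\le\tau'$ if $\tau_v\le\tau'_v$ for all $v\in\mathbb{T}$. An event $A\subset\{-1,1\}^{\mathbb{T}}$ is increasing if its indicator function is increasing for this order. *)

(* Defs.v *)
From HB Require Import structures.
From mathcomp Require Import all_boot all_order all_algebra.
From mathcomp Require Import finmap zify ring lra.
From mathcomp Require Import all_classical all_reals.

Set Implicit Arguments.
Unset Strict Implicit.
Unset Printing Implicit Defensive.
Import Order.TTheory GRing.Theory Num.Theory.

Local Open Scope classical_set_scope.
Local Open Scope ring_scope.

(** The pair [(r, s)] stands for the point [r + exp(i pi / 3) s] of the plane. *)
Notation vertex := (int * int)%type.

(** [|r + exp(i pi / 3) s|^2 = r^2 + r s + s^2]: adjacency is Euclidean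
    distance 1. *)
Definition adj (u v : vertex) : bool :=
  let r := v.1 - u.1 in let s := v.2 - u.2 in r ^+ 2 + r * s + s ^+ 2 == 1.

(** The spin [+1] is [true] and the spin [-1] is [false].  The order on [config]
    is the library's pointwise order on functions, for [false <= true]. *)
Notation config := (vertex -> bool).

Definition pluses (sigma : config) : set vertex := [set v | sigma v = true].
Definition minuses (sigma : config) : set vertex := [set v | sigma v = false].

Definition neighborhood (G : set vertex) : set vertex :=
  [set v | exists2 u, G u & adj u v].

Definition connected_in (S : set vertex) (u v : vertex) : Prop :=
  [/\ S u, S v & exists2 p : seq vertex,
    path adj u p & last u p = v /\ (forall w, w \in p -> S w)].

Definition components (S : set vertex) : set (set vertex) :=
  [set C | exists2 u, S u & C = [set v | connected_in S u v]].

Definition components_near (G S : set vertex) : set (set vertex) :=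
  [set C | components S C /\ C `&` (G `|` neighborhood G) !=set0].

Definition edges : set (set vertex) :=
  [set E | exists u v, adj u v /\ E = [set u; v]].

Definition disagreement_edges (G : set vertex) (sigma : config) :
    set (set vertex) :=
  [set E | [/\ edges E, E `&` G !=set0 &
               exists u v, [/\ E u, E v & sigma u != sigma v]]].

(** [fset_set X] is empty when [X] is infinite; for finite [G] the sets counted
    below are finite: see [finite_components_near] and
    [finite_disagreement_edges]. *)

(** An integer, since it equals [-1] when [G] is empty. *)
Definition kcount (G : set vertex) (sigma : config) : int :=
  (#|` fset_set (components_near G (pluses sigma))|
   + #|` fset_set (components_near G (minuses sigma))|)%N%:Z - 1.

Definition ecount (G : set vertex) (sigma : config) : nat :=
  #|` fset_set (disagreement_edges G sigma)|.

Definition Sigma (G : set vertex) (tau : config) : set config :=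
  [set sigma | forall v, ~ G v -> sigma v = tau v].

Definition weight (R : realType) (G : set vertex) (n x : R) (sigma : config) : R :=
  n ^ kcount G sigma * x ^+ ecount G sigma.

(** These are finite sums for finite [G], by [finite_Sigma]. *)
Definition partition_function (R : realType) (G : set vertex) (n x : R) (tau : config) : R :=
  \sum_(sigma \in Sigma G tau) weight G n x sigma.

Definition mu (R : realType) (G : set vertex) (n x : R) (tau : config)
    (A : set config) : R :=
  \sum_(sigma \in Sigma G tau `&` A) (weight G n x sigma / partition_function G n x tau).

Definition increasing_event (A : set config) : Prop :=
  {homo (fun sigma => sigma \in A) : sigma sigma' / (sigma <= sigma')%O}.

Lemma adj_sym (u v : vertex) : adj u v = adj v u.
Proof.
rewrite /adj -(opprB u.1) -(opprB u.2) !sqrrN mulrNN; by [].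
Qed.

Lemma adj_bound (u v : vertex) : adj u v ->
  exists a b : 'I_3, v = (u.1 + (a%:Z - 1), u.2 + (b%:Z - 1)).
Proof.
case: u v => [u1 u2] [v1 v2]; rewrite /adj /= => /eqP rs.
have bd (a b : int) : a ^+ 2 + a * b + b ^+ 2 = 1 ->
    exists i : 'I_3, a = i%:Z - 1.
  rewrite !expr2 => ab; have a_ge : -1 <= a by nia.
  have a_le : a <= 1 by nia.
  have lt3 : (`|(a + 1)%R| < 3)%N by lia.
  by exists (Ordinal lt3) => /=; lia.
have [i ri] := bd _ _ rs.
have [j sj] : exists i : 'I_3, v2 - u2 = i%:Z - 1.
  by apply: (bd _ (v1 - u1)); rewrite -[RHS]rs; ring.
by exists i, j; rewrite -ri -sj; congr pair; ring.
Qed.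

Lemma finite_neighborhood (G : set vertex) :
  finite_set G -> finite_set (neighborhood G).
Proof.
move=> finG; pose f (t : vertex * ('I_3 * 'I_3)) : vertex :=
  (t.1.1 + (t.2.1%:Z - 1), t.1.2 + (t.2.2%:Z - 1)).
apply: (@sub_finite_set _ _ (f @` (G `*` [set: 'I_3 * 'I_3]))).
  move=> v [u Gu /adj_bound[a [b ->]]].
  by exists (u, (a, b)).
by apply: finite_image; apply: finite_setX => //; exact: finite_finset.
Qed.

Lemma connected_in_refl (S : set vertex) (u : vertex) :
  S u -> connected_in S u u.
Proof. by move=> Su; split=> //; exists [::]. Qed.

Lemma connected_in_trans (S : set vertex) (u v w : vertex) :
  connected_in S u v -> connected_in S v w -> connected_in S u w.
Proof.
move=> [Su Sv [p up [lp pS]]] [_ Sw [q vq [lq qS]]]; split=> //.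
exists (p ++ q); first by rewrite cat_path up lp.
split; first by rewrite last_cat lp.
by move=> z; rewrite mem_cat => /orP[/pS|/qS].
Qed.

Lemma connected_in_sym (S : set vertex) (u v : vertex) :
  connected_in S u v -> connected_in S v u.
Proof.
move=> [Su Sv [p up [lp pS]]]; split=> //.
exists (rev (belast u p)).
  rewrite -lp rev_path -(eq_path (e := adj)) // => a b; exact: adj_sym.
split; first by case: p lp {up pS} => //= a p _; rewrite rev_cons last_rcons.
by move=> w; rewrite mem_rev => /mem_belast; rewrite inE => /orP[/eqP->|/pS].
Qed.

Lemma finite_components_near (G S : set vertex) :
  finite_set G -> finite_set (components_near G S).
Proof.
move=> finG.
apply: (@sub_finite_set _ _ ((fun u => [set v | connected_in S u v]) @`
                             (G `|` neighborhood G))); last first.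
  apply: finite_image; rewrite finite_setU; split=> //.
  exact: finite_neighborhood.
move=> _ [[u Su ->] [v /= [uv vG]]]; exists v => //.
apply/seteqP; split=> w /=; first exact: connected_in_trans.
exact/connected_in_trans/connected_in_sym.
Qed.

Lemma finite_disagreement_edges (G : set vertex) (sigma : config) :
  finite_set G -> finite_set (disagreement_edges G sigma).
Proof.
move=> finG; have finN := finite_neighborhood finG.
apply: (@sub_finite_set _ _ ((fun t => [set t.1; t.2]) @`
                             (G `*` neighborhood G))); last first.
  exact/finite_image/finite_setX.
move=> _ [[u [v [uv ->]]] [w [uvw Gw]] _].
case: uvw Gw => -> Gw; first by exists (u, v) => //; split=> //; exists u.
exists (v, u); last by rewrite setUC.
by split=> //; exists v => //; rewrite adj_sym.
Qed.

Lemma finite_Sigma (G : set vertex) (tau : config) :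
  finite_set G -> finite_set (Sigma G tau).
Proof.
move=> finG; pose g (f : {ffun fset_set G -> bool}) (v : vertex) :=
  if insub v is Some i then f i else tau v.
apply: (@sub_finite_set _ _ (g @` setT)); last first.
  by apply: finite_image; exact: finite_finset.
move=> sigma st; exists [ffun i => sigma (val i)] => //.
apply/funext => v; rewrite /g; case: insubP => [i _ <-|]; first by rewrite ffunE.
by rewrite in_fset_set// => /negP vG; rewrite st// => Gv; apply: vG; rewrite inE.
Qed.

(* Main.v *)
(** Idea.  Flipping [u] in [G] from minus to plus changes [kcount] by the number
    of minus clusters touching [u] minus the number of plus clusters touching [u]
    (clusters of the configuration without [u]).  Turning a further vertex [v]
    plus can only increase this difference if [v] is not adjacent to [u], and
    lowers it by at most one if [v] is adjacent to [u], because [u] and [v] have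
    a common neighbour.  In the adjacent case the corresponding variation of
    [ecount] is [-2], so [n >= 1] and [n x^2 <= 1] make the ratio of weights of a
    single flip monotone in the configuration.  No planarity is needed, and the
    boundary conditions may differ at infinitely many vertices.  Multiplying
    single-flip ratios gives the lattice condition, also for pairs of
    configurations with ordered boundary conditions, and the four functions
    theorem of Ahlswede and Daykin then yields both inequalities. *)
Require Import Defs.
From mathcomp Require Import all_boot all_order all_algebra.
From mathcomp Require Import finmap zify ring lra.
From mathcomp Require Import all_classical all_reals.

Set Implicit Arguments.
Unset Strict Implicit.
Unset Printing Implicit Defensive.
Import Order.TTheory GRing.Theory Num.Theory.

Local Open Scope classical_set_scope.
Local Open Scope ring_scope.

(** * Cardinality of finite sets *)

Definition setcard (T : choiceType) (A : set T) : nat := #|` fset_set A|.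

(** Finiteness of [B] matters: [fset_set] is empty on an infinite set, so [setcard] would vanish
    there. *)
Lemma setcard_le (T : choiceType) (A B : set T) :
  finite_set B -> A `<=` B -> (setcard A <= setcard B)%N.
Proof.
move=> finB AB; apply: fsubset_leq_card.
by rewrite -fset_set_sub//; exact: sub_finite_set finB.
Qed.

Lemma setcard_image (T U : choiceType) (f : T -> U) (A : set T) :
  finite_set A -> (setcard (f @` A) <= setcard A)%N.
Proof.
by move=> finA; rewrite /setcard fset_set_image//; exact: leq_imfset_card.
Qed.

Lemma setcardU1 (T : choiceType) (a : T) (A : set T) :
  finite_set A -> setcard (a |` A) = ((a \notin A) + setcard A)%N.
Proof.
by move=> finA; rewrite /setcard fset_setU1// cardfsU1 in_fset_set.
Qed.

Lemma setcardID (T : choiceType) (A B : set T) : finite_set A ->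
  setcard A = (setcard (A `&` B) + setcard (A `\` B))%N.
Proof.
move=> finA; have finI : finite_set (A `&` B) by exact: sub_finite_set finA.
have finD : finite_set (A `\` B) by exact: sub_finite_set finA.
rewrite /setcard -[in LHS](setUIDK A B) fset_setU// cardfsU -fset_setI//.
by rewrite setIACA setDE setICr setI0 fset_set0 cardfs0 subn0.
Qed.

Lemma kcountE (G : set vertex) (sigma : config) :
  kcount G sigma = (setcard (components_near G (pluses sigma))
                    + setcard (components_near G (minuses sigma)))%N%:Z - 1.
Proof. by []. Qed.

Lemma ecountE (G : set vertex) (sigma : config) :
  ecount G sigma = setcard (disagreement_edges G sigma).
Proof. by []. Qed.

(** * Clusters *)

Definition component (S : set vertex) (u : vertex) : set vertex :=
  [set v | connected_in S u v].

(** Clusters are collected as sets, so that several neighbours of [u] in one cluster count once. *)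
Definition touching (S : set vertex) (u : vertex) : set (set vertex) :=
  component S @` (S `&` [set v | adj u v]).

Lemma finite_adj (u : vertex) : finite_set [set v | adj u v].
Proof.
rewrite (_ : [set v | adj u v] = neighborhood [set u]).
  exact/finite_neighborhood/finite_set1.
by apply/seteqP; split=> v /=; [exists u | case=> _ ->].
Qed.

Lemma finite_touching (S : set vertex) (u : vertex) : finite_set (touching S u).
Proof. by apply: finite_image; apply: finite_setIr; exact: finite_adj. Qed.

Lemma connected_in_step (S : set vertex) (u v w : vertex) :
  connected_in S u v -> adj v w -> S w -> connected_in S u w.
Proof.
move=> uv vw Sw; have [_ Sv _] := uv; apply: connected_in_trans uv _.
split=> //; exists [:: w]; first by rewrite /= vw.
by split=> // z; rewrite inE => /eqP ->.
Qed.

Lemma connected_in_ind (S P : set vertex) (u v : vertex) :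
  (forall a b, P a -> adj a b -> S b -> P b) ->
  connected_in S u v -> P u -> P v.
Proof.
move=> Pstep [_ _ [p up [<- pS]]]; move=> Pu.
elim: p u up pS Pu => //= w p IH u /andP[uw wp] pS Pu; apply: IH => //.
  by move=> z zp; apply: pS; rewrite inE zp orbT.
by apply: Pstep Pu uw _; apply: pS; rewrite inE eqxx.
Qed.

Lemma connected_in_sub (S S' : set vertex) (u v : vertex) :
  S `<=` S' -> connected_in S u v -> connected_in S' u v.
Proof.
move=> SS' uv; have [Su _ _] := uv.
apply: (connected_in_ind (P := component S' u) _ uv); last exact/connected_in_refl/SS'.
by move=> a b ua ab /SS'; exact: connected_in_step ua ab.
Qed.

Lemma eq_component (S : set vertex) (u v : vertex) :
  connected_in S u v -> component S u = component S v.
Proof.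
move=> uv; apply/seteqP; split=> w; apply: connected_in_trans => //.
exact: connected_in_sym.
Qed.

(** A path leaving the cluster of [y] would have to enter [u], from a neighbour of [u] in that
    cluster. *)
Lemma component_setU1 (S : set vertex) (u y : vertex) :
  S y -> ~ (exists2 z, component S y z & adj u z) ->
  component (u |` S) y = component S y.
Proof.
move=> Sy yu; apply/seteqP; split=> z; last first.
  by apply: connected_in_sub => w; right.
move=> yz; apply: (connected_in_ind (P := component S y) _ yz);
  last exact: connected_in_refl.
move=> a b ya ab [bu|Sb]; last exact: (connected_in_step ya ab Sb).
by exfalso; rewrite /= in bu; subst b; apply: yu; exists a; rewrite // adj_sym.
Qed.

(** Adding [u] to [S] merges the components touching [u] into one. *)
Lemma card_components_near_setU1 (G S : set vertex) (u : vertex) :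
  finite_set G -> G u -> ~ S u ->
  (setcard (components_near G (u |` S)) + setcard (touching S u)
   = (setcard (components_near G S)).+1)%N.
Proof.
move=> finG Gu Su.
have finS := finite_components_near S finG.
(* As [u] lies in [G], every cluster touching [u] meets the neighborhood of [G] and is therefore
   counted. *)
have touch_near : touching S u `<=` components_near G S.
  move=> _ [y [Sy uy] <-]; split; first by exists y.
  by exists y; split; [exact: connected_in_refl|right; exists u].
have -> : components_near G (u |` S) =
    component (u |` S) u |` (components_near G S `\` touching S u).
  apply/seteqP; split=> C.
    move=> [[y Sy Cy] CG]; case: (pselect (connected_in (u |` S) y u)) => yu.
      by left; rewrite Cy; exact: eq_component.
    case: Sy yu => [->|Sy] yu.
      by exfalso; apply: yu; apply: connected_in_refl; left.
    have yN : ~ exists2 z, component S y z & adj u z.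
      move=> [z yz uz]; apply: yu; apply: (@connected_in_step _ _ z).
      - by apply: connected_in_sub yz => w; right.
      - by rewrite adj_sym.
      - by left.
    have CS : C = component S y by rewrite Cy; exact: component_setU1.
    right; split; first by split=> //; exists y.
    move=> [z [Sz uz] zC]; apply: yN; exists z => //.
    by rewrite -CS -zC; exact: connected_in_refl.
  case=> [->|[[[y Sy ->] CG] Ct]].
    split; first by exists u => //; left.
    by exists u; split; [apply: connected_in_refl; left|left].
  split=> //; exists y; first by right.
  rewrite -!/(component _ _) component_setU1// => -[z yz uz].
  apply: Ct; exists z; last exact/esym/eq_component.
  by split=> //; case: yz.
(* The merged cluster contains [u], whereas the old clusters lie inside [S]. *)
have new : component (u |` S) u \notin components_near G S `\` touching S u.
  rewrite notin_setE => -[[[y Sy Cy] _] _].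
  have : component (u |` S) u u by apply: connected_in_refl; left.
  by rewrite Cy => -[].
rewrite setcardU1; last exact: finite_setD.
rewrite (setcardID (touching S u) finS) (setIidr touch_near) new.
by rewrite addnAC add1n addSn.
Qed.

(** Recovers the larger cluster from the smaller one as a set, so that the passage from clusters of
    [S] to clusters of [S'] needs no choice of base point. *)
Lemma component_sub (S S' : set vertex) (u : vertex) : S `<=` S' -> S u ->
  component S' u = \bigcup_(v in component S u) component S' v.
Proof.
move=> SS' Su; apply/seteqP; split=> w.
  by exists u => //; exact: connected_in_refl.
by move=> [v uv]; apply: connected_in_trans; exact: connected_in_sub uv.
Qed.

(** Send each cluster of [S] to the cluster of [S'] containing it: the image of [touching S u]
    covers [touching S' u]. *)
Lemma card_touching_le (S S' : set vertex) (u : vertex) : S `<=` S' ->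
  (forall y, S' y -> adj u y -> exists z, [/\ S z, adj u z & connected_in S' y z]) ->
  (setcard (touching S' u) <= setcard (touching S u))%N.
Proof.
move=> SS' S'S; pose f C := \bigcup_(v in C) component S' v.
apply: leq_trans (setcard_image f (finite_touching S u)).
apply: setcard_le; first exact/finite_image/finite_touching.
move=> _ [y [S'y uy] <-]; have [z [Sz uz yz]] := S'S y S'y uy.
exists (component S z); first by exists z.
by rewrite (eq_component yz) (component_sub SS').
Qed.

(** The same map on clusters misses at most one element, the cluster of [v]. *)
Lemma card_touching_le_succ (S S' : set vertex) (u v : vertex) : S `<=` S' ->
  (forall y, S' y -> adj u y -> y = v \/ S y) ->
  (setcard (touching S' u) <= (setcard (touching S u)).+1)%N.
Proof.
move=> SS' S'S; pose f C := \bigcup_(v in C) component S' v.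
have finfT : finite_set (f @` touching S u) by exact/finite_image/finite_touching.
have := setcard_image f (finite_touching S u); rewrite -ltnS.
apply: leq_trans; apply: (@leq_trans (setcard (component S' v |` f @` touching S u))).
  apply: setcard_le; first by rewrite finite_setU; split.
  move=> _ [y [S'y uy] <-]; have [->|Sy] := S'S y S'y uy; [by left|right].
  by exists (component S y); [exists y|rewrite (component_sub SS')].
by rewrite setcardU1// -add1n leq_add2r; case: (_ \in _).
Qed.

(** * Variation of the number of clusters *)

Definition set_spin (sigma : config) (u : vertex) (b : bool) : config :=
  fun v => if v == u then b else sigma v.

Lemma pluses_set_spin (sigma : config) (u : vertex) :
  pluses (set_spin sigma u true) = u |` pluses sigma.
Proof.
apply/seteqP; split=> v; rewrite /pluses /set_spin /=.
  by case: eqP => [->|_]; [left|right].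
by move=> [->|sv]; rewrite ?eqxx// sv; case: ifP.
Qed.

Lemma minuses_set_spin (sigma : config) (u : vertex) : sigma u = false ->
  minuses sigma = u |` minuses (set_spin sigma u true).
Proof.
move=> su; apply/seteqP; split=> v; rewrite /minuses /set_spin /=.
  by case: eqP => [->|_]; [left|right].
by move=> [->|]//; case: ifP.
Qed.

(** The merging count is applied to the pluses of [sigma] and, in reverse, to the minuses left after
    the flip; the two unit terms cancel. *)
Lemma kcount_flip (G : set vertex) (sigma : config) (u : vertex) :
  finite_set G -> G u -> sigma u = false ->
  kcount G (set_spin sigma u true) + (setcard (touching (pluses sigma) u))%:Z
  = kcount G sigma
    + (setcard (touching (minuses (set_spin sigma u true)) u))%:Z.
Proof.
move=> finG Gu su; rewrite !kcountE pluses_set_spin (minuses_set_spin su).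
have plusP := @card_components_near_setU1 G (pluses sigma) u finG Gu.
have minusP := @card_components_near_setU1 G
  (minuses (set_spin sigma u true)) u finG Gu.
have {}plusP := plusP ltac:(by rewrite /pluses /= su).
have {}minusP := minusP ltac:(by rewrite /minuses /set_spin /= eqxx).
lia.
Qed.

(** With the neighbours of [u] unchanged and pluses added elsewhere, plus clusters touching [u] can
    only merge and minus clusters can only split. *)
Lemma kcount_flip_far (G : set vertex) (sigma sigma' : config) (u : vertex) :
  finite_set G -> G u -> sigma u = false -> sigma' u = false ->
  (forall v, sigma v -> sigma' v) -> (forall v, adj u v -> sigma v = sigma' v) ->
  kcount G (set_spin sigma u true) + kcount G sigma'
  <= kcount G (set_spin sigma' u true) + kcount G sigma.
Proof.
move=> finG Gu su s'u ss' ss'u.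
have kP := kcount_flip finG Gu su; have k'P := kcount_flip finG Gu s'u.
have plus_le : (setcard (touching (pluses sigma') u)
    <= setcard (touching (pluses sigma) u))%N.
  apply: card_touching_le => [v /ss'//|y s'y uy].
  by exists y; split=> //; [rewrite /pluses /= ss'u|exact: connected_in_refl].
have minus_le : (setcard (touching (minuses (set_spin sigma u true)) u)
    <= setcard (touching (minuses (set_spin sigma' u true)) u))%N.
  apply: card_touching_le => [v|y sy uy].
    rewrite /minuses /set_spin /=; case: ifP => // _.
    by move=> s'v; apply/negP => /ss'; rewrite s'v.
  exists y; split=> //; last exact: connected_in_refl.
  by move: sy; rewrite /minuses /set_spin /=; case: ifP => // _; rewrite ss'u.
lia.
Qed.

Lemma adj_common (u v : vertex) : adj u v -> exists w, adj u w && adj w v.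
Proof.
case: u v => [u1 u2] [v1 v2]; rewrite /adj /= => /eqP uv.
(* The vector from [u] to this vertex is [v - u] rotated by pi/3, which closes an equilateral
   triangle. *)
exists (u1 - (v2 - u2), u2 + (v1 - u1) + (v2 - u2)) => /=.
by apply/andP; split; apply/eqP; rewrite -[RHS]uv; ring.
Qed.

Lemma adj_neq (u v : vertex) : adj u v -> v != u.
Proof.
by apply: contraTneq => ->; rewrite /adj /= !subrr.
Qed.

(** A common neighbour [w] of [u] and [v] is plus or minus; accordingly, the
    plus or the minus cluster of [v] touches [u] already through [w]. *)
Lemma kcount_flip_near (G : set vertex) (sigma : config) (u v : vertex) :
  finite_set G -> G u -> sigma u = false -> adj u v -> sigma v = false ->
  kcount G (set_spin sigma u true) + kcount G (set_spin sigma v true)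
  <= kcount G (set_spin (set_spin sigma v true) u true) + kcount G sigma + 1.
Proof.
move=> finG Gu su uv sv; set sigma' := set_spin sigma v true.
have vu := adj_neq uv.
have s'u : sigma' u = false by rewrite /sigma' /set_spin eq_sym (negPf vu).
have kP := kcount_flip finG Gu su; have k'P := kcount_flip finG Gu s'u.
pose M := minuses (set_spin sigma u true).
pose M' := minuses (set_spin sigma' u true).
rewrite -/M in kP; rewrite -/M' in k'P.
have SS' : pluses sigma `<=` pluses sigma'.
  by rewrite /sigma' pluses_set_spin => w; right.
have M'M : M' `<=` M.
  move=> w; rewrite /M' /M /minuses /sigma' /set_spin /=.
  by case: ifP => // _; case: ifP.
have S'S y : pluses sigma' y -> adj u y -> y = v \/ pluses sigma y.
  by rewrite /sigma' pluses_set_spin => -[->|Sy] _; [left|right].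
have MM' y : M y -> adj u y -> y = v \/ M' y.
  rewrite /M' /M /minuses /sigma' /set_spin /=.
  by case: ifP => // _ sy _; case: eqP; [left|right].
have [w /andP[uw wv]] := adj_common uv.
have wu := adj_neq uw; have vw := adj_neq wv.
have plus_le := card_touching_le_succ SS' S'S.
have minus_le := card_touching_le_succ M'M MM'.
have Mv : M v by rewrite /M /minuses /set_spin /= (negPf vu).
have S'v : pluses sigma' v by rewrite /sigma' /pluses /set_spin /= eqxx.
(* Each of [plus_le] and [minus_le] may lose one. The colour of [w] removes the loss from one of
   them, so the total defect is 1 and not 2. *)
case sw : (sigma w).
  suff : (setcard (touching (pluses sigma') u)
      <= setcard (touching (pluses sigma) u))%N by lia.
  apply: card_touching_le => // y S'y uy; have [->|Sy] := S'S y S'y uy.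
    exists w; split=> //; apply: connected_in_step (connected_in_refl S'v) _ _.
      by rewrite adj_sym.
    exact: SS'.
  by exists y; split=> //; exact: connected_in_refl.
have M'w : M' w.
  by rewrite /M' /minuses /sigma' /set_spin /= (negPf wu) eq_sym (negPf vw).
suff : (setcard (touching M u) <= setcard (touching M' u))%N by lia.
apply: card_touching_le => // y My uy; have [->|M'y] := MM' y My uy.
  exists w; split=> //; apply: connected_in_step (connected_in_refl Mv) _ _.
    by rewrite adj_sym.
  exact: M'M.
by exists y; split=> //; exact: connected_in_refl.
Qed.

(** * Variation of the number of disagreement edges *)

Lemma disagreement_edges_subset (G : set vertex) (sigma sigma' : config)
    (P : set (set vertex)) :
  (forall E v, edges E -> P E -> E v -> sigma v = sigma' v) ->
  disagreement_edges G sigma `&` P `<=` disagreement_edges G sigma' `&` P.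
Proof.
move=> eqP E [[eE EG [v [w [Ev Ew svw]]]] PE]; split=> //; split=> //.
by exists v, w; split=> //; rewrite -!(eqP E).
Qed.

Lemma eq_disagreement_edges (G : set vertex) (sigma sigma' : config)
    (P : set (set vertex)) :
  (forall E v, edges E -> P E -> E v -> sigma v = sigma' v) ->
  disagreement_edges G sigma `&` P = disagreement_edges G sigma' `&` P.
Proof.
by move=> eqP; apply/seteqP; split; apply: disagreement_edges_subset => E v *;
  rewrite (eqP E).
Qed.

Lemma edges_adj (E : set vertex) (u v : vertex) :
  edges E -> E u -> E v -> v = u \/ adj u v.
Proof.
move=> [a [b [ab ->]]] [->|->] [->|->]; [by left|by right|right|by left].
by rewrite adj_sym.
Qed.

Lemma edges_eq (E : set vertex) (u v : vertex) :
  edges E -> E u -> E v -> u != v -> E = [set u; v].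
Proof.
move=> [a [b [ab ->]]] [->|->] [->|->]; rewrite ?eqxx// => _.
by rewrite setUC.
Qed.

(** Edges avoiding [u] do not see the flip, so the whole variation comes from edges at [u]. *)
Lemma ecount_split (G : set vertex) (sigma : config) (u : vertex) :
  finite_set G -> sigma u = false ->
  let D sigma := disagreement_edges G sigma `&` [set E | E u] in
  (ecount G (set_spin sigma u true) + setcard (D sigma)
   = ecount G sigma + setcard (D (set_spin sigma u true)))%N.
Proof.
move=> finG su D; rewrite !ecountE.
have splitE s := setcardID [set E | E u] (finite_disagreement_edges s finG).
rewrite (splitE sigma) (splitE (set_spin sigma u true)) -!/(D _) !setDE.
rewrite (@eq_disagreement_edges G (set_spin sigma u true) sigma (~` [set E | E u])).
  by rewrite addnC addnCA addnC.
by move=> E v _ Eu Ev; rewrite /set_spin; case: eqP => // vu; rewrite vu in Ev.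
Qed.

Lemma ecount_flip_far (G : set vertex) (sigma sigma' : config) (u : vertex) :
  finite_set G -> sigma u = false -> sigma' u = false ->
  (forall v, adj u v -> sigma v = sigma' v) ->
  (ecount G (set_spin sigma u true) + ecount G sigma'
   = ecount G (set_spin sigma' u true) + ecount G sigma)%N.
Proof.
move=> finG su s'u ss'.
have := ecount_split finG su; have := ecount_split finG s'u; rewrite /=.
rewrite (@eq_disagreement_edges G sigma sigma') => [|E v eE Eu Ev]; last first.
  by have [->|/ss'//] := edges_adj eE Eu Ev; rewrite su.
rewrite (@eq_disagreement_edges G (set_spin sigma u true) (set_spin sigma' u true)).
  lia.
move=> E v eE Eu Ev; rewrite /set_spin; case: eqP => // /eqP vu.
by have [/eqP|/ss'//] := edges_adj eE Eu Ev; rewrite (negPf vu).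
Qed.

(** Among the edges at [u], only the edge from [u] to [v] sees the spin at [v]; it disagrees in
    [sigma] and agrees in [sigma']. *)
Lemma card_disagreement_edges_at (G : set vertex) (sigma sigma' : config)
    (u v : vertex) :
  finite_set G -> G u -> adj u v -> (forall w, w != v -> sigma w = sigma' w) ->
  sigma u != sigma v -> sigma' u = sigma' v ->
  let D sigma := disagreement_edges G sigma `&` [set E | E u] in
  (setcard (D sigma) = (setcard (D sigma')).+1)%N.
Proof.
move=> finG Gu uv ss' suv s'uv D.
have vu := adj_neq uv.
have finD : finite_set (D sigma').
  by apply: finite_setIl; exact: finite_disagreement_edges.
have -> : D sigma = [set u; v] |` D sigma'.
  apply/seteqP; split=> E.
    move=> [[eE EG [a [b [Ea Eb sab]]]] Eu].
    case: (pselect (E v)) => Ev.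
      by left; apply: edges_eq => //; rewrite eq_sym.
    right; split=> //; split=> //; exists a, b; split=> //.
    by rewrite -!ss'//; apply: contra_notN Ev => /eqP <-.
  case=> [->|[[eE EG [a [b [Ea Eb sab]]]] Eu]].
    split; last by left.
    split; [by exists u, v|by exists u; split=> //; left|].
    by exists u, v; split=> //; [left|right].
  split=> //; split=> //; exists a, b; split=> //.
  suff Ev : ~ E v by rewrite !ss'//; apply: contra_notN Ev => /eqP <-.
  move=> Ev; move: Ea Eb sab; rewrite (@edges_eq E u v)//; last by rewrite eq_sym.
  by move=> [->|->] [->|->]; rewrite ?s'uv eqxx.
rewrite setcardU1//; suff -> : [set u; v] \notin D sigma' by rewrite add1n.
rewrite notin_setE => -[[_ _ [a [b [Ea Eb sab]]]] _].
by move: Ea Eb sab => [->|->] [->|->]; rewrite ?s'uv eqxx.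
Qed.

(** The 2 is the edge between [u] and [v]: it disagrees when exactly one endpoint is flipped and
    agrees when none or both are. *)
Lemma ecount_flip_near (G : set vertex) (sigma : config) (u v : vertex) :
  finite_set G -> G u -> sigma u = false -> adj u v -> sigma v = false ->
  (ecount G (set_spin sigma u true) + ecount G (set_spin sigma v true)
   = ecount G (set_spin (set_spin sigma v true) u true) + ecount G sigma + 2)%N.
Proof.
move=> finG Gu su uv sv; set sigma' := set_spin sigma v true.
have vu := adj_neq uv.
have s'u : sigma' u = false by rewrite /sigma' /set_spin eq_sym (negPf vu).
have s'v : sigma' v = true by rewrite /sigma' /set_spin eqxx.
have off w : w != v -> sigma' w = sigma w.
  by rewrite /sigma' /set_spin => /negPf ->.
have := ecount_split finG su; have := ecount_split finG s'u; rewrite /=.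
rewrite (@card_disagreement_edges_at G sigma' sigma u v)//; last 2 first.
- by rewrite s'u s'v.
- by rewrite su sv.
rewrite (@card_disagreement_edges_at G (set_spin sigma u true)
  (set_spin sigma' u true) u v)//; first lia.
- by move=> w wv; rewrite /set_spin; case: ifP => // _; rewrite off.
- by rewrite /set_spin eqxx (negPf vu) sv.
- by rewrite /set_spin eqxx (negPf vu) s'v.
Qed.

(** * Lattice condition *)

Section Weight.
Context (R : realType) (n x : R) (n_ge1 : 1 <= n) (x_gt0 : 0 < x).
Context (nx2_le1 : n * x ^+ 2 <= 1).
Context (G : set vertex) (finG : finite_set G).

Let n_gt0 : 0 < n. Proof. exact: lt_le_trans n_ge1. Qed.

Lemma weight_gt0 (sigma : config) : 0 < weight G n x sigma.
Proof. by rewrite /weight mulr_gt0// ?exprz_gt0// exprn_gt0. Qed.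

Definition flip_ratio (u : vertex) (sigma : config) : R :=
  weight G n x (set_spin sigma u true) / weight G n x sigma.

(** The powers of [x] coincide, and [n >= 1] turns the inequality on [kcount] into one on
    weights. *)
Lemma flip_ratio_far (sigma sigma' : config) (u : vertex) :
  G u -> sigma u = false -> sigma' u = false ->
  (forall v, sigma v -> sigma' v) -> (forall v, adj u v -> sigma v = sigma' v) ->
  flip_ratio u sigma <= flip_ratio u sigma'.
Proof.
move=> Gu su s'u ss' ss'u; rewrite /flip_ratio ler_pdivrMr ?weight_gt0//.
rewrite mulrAC ler_pdivlMr ?weight_gt0// /weight !(mulrACA _ (x ^+ _)).
rewrite -!exprD (ecount_flip_far finG su s'u ss'u) ler_pM2r ?exprn_gt0//.
rewrite -!expfzDr ?gt_eqF//; apply: ler_weXz2l => //.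
exact: kcount_flip_far.
Qed.

Lemma flip_ratio_near (sigma : config) (u v : vertex) :
  G u -> sigma u = false -> adj u v -> sigma v = false ->
  flip_ratio u sigma <= flip_ratio u (set_spin sigma v true).
Proof.
move=> Gu su uv sv; rewrite /flip_ratio ler_pdivrMr ?weight_gt0//.
rewrite mulrAC ler_pdivlMr ?weight_gt0// /weight !(mulrACA _ (x ^+ _)).
rewrite -!exprD (ecount_flip_near finG Gu su uv sv) exprD.
rewrite (mulrC (x ^+ _) (x ^+ 2)) mulrA ler_pM2r ?exprn_gt0//.
rewrite -!expfzDr ?gt_eqF//.
(* The defect 1 in [kcount] costs a factor [n], the 2 in [ecount] gives [x ^+ 2]; their product is
   at most 1. *)
apply: (@le_trans _ _ (n ^ (kcount G (set_spin (set_spin sigma v true) u true)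
                            + kcount G sigma + 1) * x ^+ 2)).
  rewrite ler_pM2r ?exprn_gt0//; apply: ler_weXz2l => //.
  exact: kcount_flip_near.
rewrite [n ^ (_ + 1)]expfzDr ?gt_eqF// expr1z -mulrA ler_piMr//.
exact/ltW/exprz_gt0.
Qed.

(** The neighbours of [u] where [sigma] and [sigma'] differ are raised one at a time; then the two
    agree around [u] and [flip_ratio_far] concludes. *)
Lemma flip_ratio_mono (sigma sigma' : config) (u : vertex) :
  G u -> sigma u = false -> sigma' u = false -> (forall v, sigma v -> sigma' v) ->
  flip_ratio u sigma <= flip_ratio u sigma'.
Proof.
move=> Gu su s'u ss'.
(* The induction runs on a list covering the neighbours still to be raised. It is finite even if the
   configurations differ at infinitely many vertices. *)
have [l lP] : exists l : seq vertex,
    forall v, adj u v -> sigma v != sigma' v -> v \in l.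
  exists (fset_set [set v | adj u v]) => v uv _.
  by rewrite in_fset_set ?mem_set//; exact: finite_adj.
elim: l sigma su ss' lP => [|v l IH] sigma su ss' lP.
  by apply: flip_ratio_far => // v /lP; case: eqP => // _ /(_ isT).
case: (boolP (adj u v && (sigma v != sigma' v))) => [/andP[uv svs'v]|uvN].
  have sv : sigma v = false by apply: contraNF svs'v => sv; rewrite sv ss'.
  have s'v : sigma' v by move: svs'v; rewrite sv; case: (sigma' v).
  apply: (le_trans (flip_ratio_near Gu su uv sv)); apply: IH.
  - by rewrite /set_spin eq_sym (negPf (adj_neq uv)).
  - by move=> w; rewrite /set_spin; case: eqP => [->//|_ /ss'].
  - move=> w uw; rewrite /set_spin; case: (eqVneq w v) => [->|wv].
      by rewrite s'v.
    by move=> /(lP _ uw); rewrite inE (negPf wv).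
apply: IH => // w uw sw; have := lP _ uw sw; rewrite inE => /orP[/eqP wv|//].
by rewrite wv in uw sw; rewrite uw sw in uvN.
Qed.

Definition raise (s : seq vertex) (sigma : config) : config :=
  fun v => (v \in s) || sigma v.

Lemma raise_cons (u : vertex) (s : seq vertex) (sigma : config) :
  raise (u :: s) sigma = raise s (set_spin sigma u true).
Proof.
apply/funext => v; rewrite /raise /set_spin inE.
by case: (v == u); rewrite ?orbT.
Qed.

(** Both sides telescope into products of single-flip ratios, compared factor by factor with
    [flip_ratio_mono]. *)
Lemma weight_raise (s : seq vertex) (sigma sigma' : config) :
  uniq s -> (forall v, v \in s -> G v) -> (forall v, v \in s -> sigma' v = false) ->
  (forall v, sigma v -> sigma' v) ->
  weight G n x (raise s sigma) / weight G n x sigma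
  <= weight G n x (raise s sigma') / weight G n x sigma'.
Proof.
elim: s sigma sigma' => [|u s IH] sigma sigma' /=.
  have raise0 tau : raise [::] tau = tau by apply/funext.
  by rewrite !raise0 !divff ?gt_eqF ?weight_gt0.
move=> /andP[us uniqs] sG s's ss'; rewrite !raise_cons.
have split_ratio tau : weight G n x (raise s (set_spin tau u true)) / weight G n x tau
    = weight G n x (raise s (set_spin tau u true))
      / weight G n x (set_spin tau u true) * flip_ratio u tau.
  by rewrite /flip_ratio mulrA divfK// gt_eqF ?weight_gt0.
rewrite !split_ratio; apply: ler_pM.
- by rewrite divr_ge0// ltW ?weight_gt0.
- by rewrite divr_ge0// ltW ?weight_gt0.
- apply: IH => // v.
  + by move=> vs; apply: sG; rewrite inE vs orbT.
  + move=> vs; rewrite /set_spin; case: eqP => [vu|_]; first by rewrite -vu vs in us.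
    by apply: s's; rewrite inE vs orbT.
  + by rewrite /set_spin; case: eqP => // _; exact: ss'.
- have s'u := s's _ (mem_head u s).
  apply: flip_ratio_mono => //; first by apply: sG; rewrite mem_head.
  by apply: contraFF s'u => /ss'.
Qed.

(** Raising the vertices that are plus in [sigma] and minus in [sigma'] turns the meet into [sigma]
    and [sigma'] into the join; [weight_raise] compares the two ratios. *)
Lemma weight_lattice (tau tau' sigma sigma' : config) :
  (forall v, tau v -> tau' v) -> Sigma G tau sigma -> Sigma G tau' sigma' ->
  weight G n x sigma * weight G n x sigma'
  <= weight G n x (fun v => sigma v || sigma' v)
     * weight G n x (fun v => sigma v && sigma' v).
Proof.
move=> tt' st s't'.
pose meet : config := fun v => sigma v && sigma' v.
pose s := [seq v <- fset_set G | sigma v && ~~ sigma' v].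
(* Such vertices lie in [G], since outside [G] the configurations are [tau] and [tau'], which are
   ordered. *)
have mem_s v : (v \in s) = sigma v && ~~ sigma' v.
  rewrite mem_filter in_fset_set// andb_idr// => /andP[sv s'v].
  apply/mem_set; apply: contrapT => Gv; move: sv s'v.
  by rewrite st// s't'// => /tt' ->.
have := @weight_raise s meet sigma' _ _ _ _.
have -> : raise s meet = sigma.
  by apply/funext => v; rewrite /raise /meet mem_s; case: (sigma v); case: (sigma' v).
have -> : raise s sigma' = (fun v => sigma v || sigma' v).
  by apply/funext => v; rewrite /raise mem_s; case: (sigma v); case: (sigma' v).
rewrite ler_pdivrMr ?weight_gt0// mulrAC ler_pdivlMr ?weight_gt0//; apply.
- by rewrite filter_uniq// fset_uniq.
- by move=> v; rewrite mem_filter in_fset_set// => /andP[_]; rewrite inE.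
- by move=> v; rewrite mem_s => /andP[_ /negPf].
- by move=> v /andP[].
Qed.

End Weight.

(** * Four functions theorem *)

(** Moves the free spin at [u] into the boundary condition, which allows induction on [G]. *)
Lemma SigmaU1 (u : vertex) (G : set vertex) (tau : config) :
  Sigma (u |` G) tau
  = Sigma G (set_spin tau u true) `|` Sigma G (set_spin tau u false).
Proof.
apply/seteqP; split=> sigma.
  move=> st; case su : (sigma u); [left|right] => v Gv; rewrite /set_spin;
    by case: eqP => [->//|vu]; apply: st => -[].
by move=> [st|st] v /not_orP[/eqP/negPf vu Gv]; rewrite st// /set_spin vu.
Qed.

Lemma sum_SigmaU1 (R : realType) (f : config -> R) (u : vertex) (G : set vertex)
    (tau : config) : finite_set G -> ~ G u ->
  \sum_(sigma \in Sigma (u |` G) tau) f sigma =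
  \sum_(sigma \in Sigma G (set_spin tau u true)) f sigma
  + \sum_(sigma \in Sigma G (set_spin tau u false)) f sigma.
Proof.
move=> finG Gu; rewrite SigmaU1 fsbigU0//; try exact: finite_Sigma.
by move=> sigma [/(_ _ Gu) st /(_ _ Gu)]; rewrite st /set_spin eqxx.
Qed.

(** One-vertex case of the four functions theorem. The diagonal products are bounded directly, so
    only the sum of the two mixed products needs an argument. *)
Lemma four_functions_bool (R : realDomainType) (a0 a1 b0 b1 c0 c1 d0 d1 : R) :
  0 <= a0 -> 0 <= a1 -> 0 <= b0 -> 0 <= b1 ->
  0 <= c0 -> 0 <= c1 -> 0 <= d0 -> 0 <= d1 ->
  a0 * b0 <= c0 * d0 -> a0 * b1 <= c1 * d0 ->
  a1 * b0 <= c1 * d0 -> a1 * b1 <= c1 * d1 ->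
  (a1 + a0) * (b1 + b0) <= (c1 + c0) * (d1 + d0).
Proof.
move=> a0_ge0 a1_ge0 b0_ge0 b1_ge0 c0_ge0 c1_ge0 d0_ge0 d1_ge0 h00 h01 h10 h11.
suff cross : a0 * b1 + a1 * b0 <= c1 * d0 + c0 * d1 by lra.
have prod_le : (a0 * b1) * (a1 * b0) <= (c1 * d0) * (c0 * d1).
  rewrite (_ : _ * _ * _ = (a0 * b0) * (a1 * b1)); last by ring.
  rewrite (_ : c1 * d0 * _ = (c0 * d0) * (c1 * d1)); last by ring.
  by rewrite ler_pM// mulr_ge0.
have := mulr_ge0 a0_ge0 b1_ge0; have := mulr_ge0 a1_ge0 b0_ge0.
have := mulr_ge0 c0_ge0 d1_ge0; have := mulr_ge0 c1_ge0 d0_ge0.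
move: {h00 h11} (a0 * b1) (a1 * b0) (c1 * d0) (c0 * d1) h01 h10 prod_le
  => p q m r pm qm pqmr.
(* If [m = 0] then [p] and [q] are nonpositive. Otherwise [m * (p + q) <= m ^+ 2 + p * q <= m * (m +
   r)], and [m] cancels. *)
rewrite le_eqVlt => /orP[/eqP m0 r_ge0 _ _|m_gt0 r_ge0 q_ge0 p_ge0].
  by move: pm qm; rewrite -m0; lra.
have : 0 <= (m - p) * (m - q) by rewrite mulr_ge0// subr_ge0.
by rewrite -(ler_pM2l m_gt0); nra.
Qed.

Lemma set_spin_or (sigma sigma' : config) (u : vertex) (b b' : bool) :
  (fun v => set_spin sigma u b v || set_spin sigma' u b' v)
  = set_spin (fun v => sigma v || sigma' v) u (b || b').
Proof. by apply/funext => v; rewrite /set_spin; case: eqP. Qed.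

Lemma set_spin_and (sigma sigma' : config) (u : vertex) (b b' : bool) :
  (fun v => set_spin sigma u b v && set_spin sigma' u b' v)
  = set_spin (fun v => sigma v && sigma' v) u (b && b').
Proof. by apply/funext => v; rewrite /set_spin; case: eqP. Qed.

Lemma four_functions (R : realType) (f1 f2 f3 f4 : config -> R) (G : set vertex)
    (tau tau' : config) : finite_set G ->
  (forall sigma, 0 <= f1 sigma) -> (forall sigma, 0 <= f2 sigma) ->
  (forall sigma, 0 <= f3 sigma) -> (forall sigma, 0 <= f4 sigma) ->
  (forall sigma sigma', Sigma G tau sigma -> Sigma G tau' sigma' ->
     f1 sigma * f2 sigma' <=
     f3 (fun v => sigma v || sigma' v) * f4 (fun v => sigma v && sigma' v)) ->
  (\sum_(sigma \in Sigma G tau) f1 sigma) * (\sum_(sigma \in Sigma G tau') f2 sigma)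
  <= (\sum_(sigma \in Sigma G (fun v => tau v || tau' v)) f3 sigma)
     * (\sum_(sigma \in Sigma G (fun v => tau v && tau' v)) f4 sigma).
Proof.
move=> finG f1_ge0 f2_ge0 f3_ge0 f4_ge0.
have [s [uniqs ->]] : exists s : seq vertex, uniq s /\ G = [set` s].
  by exists (fset_set G); rewrite fset_uniq fset_setK.
(* The boundary conditions stay general because each step fixes the spin at [u] in them. *)
elim: s uniqs tau tau' => [_|u s IH /= /andP[us /IH{}IH]] tau tau' fP.
  have Sigma0 t : Sigma [set` [::]] t = [set t].
    by apply/seteqP; split=> [sigma st|_ -> v //]; apply/funext => v; exact: st.
  by rewrite !Sigma0 !fsbig_set1; apply: fP.
have fin_s : finite_set [set` s] by exact: finite_seq.
have usN : ~ [set` s] u by exact/negP.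
have consE : [set` u :: s] = u |` [set` s].
  by apply/seteqP; split=> v; rewrite /= inE => /predU1P.
move: fP; rewrite consE !sum_SigmaU1// SigmaU1 SigmaU1 => fP.
have sum_ge0 (f : config -> R) t : (forall sigma, 0 <= f sigma) ->
    0 <= \sum_(sigma \in Sigma [set` s] t) f sigma by move=> f_ge0; exact: fsumr_ge0.
have step b b' := IH (set_spin tau u b) (set_spin tau' u b').
apply: four_functions_bool; do ?exact: sum_ge0.
- have := step false false; rewrite set_spin_or set_spin_and; apply.
  by move=> sigma sigma' st s't'; apply: fP; right.
(* Both mixed cases have join plus and meet minus at [u], hence the same right-hand side. *)
- have := step false true; rewrite set_spin_or set_spin_and; apply.
  by move=> sigma sigma' st s't'; apply: fP; [right|left].
- have := step true false; rewrite set_spin_or set_spin_and; apply.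
  by move=> sigma sigma' st s't'; apply: fP; [left|right].
- have := step true true; rewrite set_spin_or set_spin_and; apply.
  by move=> sigma sigma' st s't'; apply: fP; left.
Qed.

(** * From weights to the measure *)

Section Measure.
Context (R : realType) (n x : R) (n_ge1 : 1 <= n) (x_gt0 : 0 < x).
Context (nx2_le1 : n * x ^+ 2 <= 1).
Context (G : set vertex) (finG : finite_set G).

(** The unnormalized measure; its value at [setT] is the partition function. *)
Definition mass (tau : config) (A : set config) : R :=
  \sum_(sigma \in Sigma G tau `&` A) weight G n x sigma.

Lemma muE (tau : config) (A : set config) :
  mu G n x tau A = mass tau A / mass tau setT.
Proof. by rewrite /mu /mass /partition_function setIT mulr_fsuml. Qed.

Lemma mass_gt0 (tau : config) : 0 < mass tau setT.
Proof.
rewrite /mass setIT (fsbigD1 tau)//; last exact: finite_Sigma.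
rewrite ltr_wpDr ?weight_gt0//.
by apply: fsumr_ge0 => sigma _; exact/ltW/weight_gt0.
Qed.

Lemma increasing_eventP (A : set config) (sigma sigma' : config) :
  increasing_event A -> (forall v, sigma v -> sigma' v) -> A sigma -> A sigma'.
Proof.
move=> incA ss' /mem_set As; apply/set_mem.
have /incA : (sigma <= sigma')%O
  by apply/lefP => v; have := ss' v; case: (sigma v) => // ->.
by rewrite As; case: (sigma' \in A).
Qed.

(** [tau = tau'] is the FKG inequality, [B = setT] the comparison of boundary
    conditions. *)
Lemma mass_mul_le (tau tau' : config) (A B : set config) :
  (forall v, tau v -> tau' v) -> increasing_event A -> increasing_event B ->
  mass tau A * mass tau' B <= mass tau' (A `&` B) * mass tau setT.
Proof.
move=> tt' incA incB; rewrite /mass !fsbig_mkcondr.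
pose f (C : set config) sigma := if sigma \in C then weight G n x sigma else 0.
have f_ge0 C sigma : 0 <= f C sigma.
  by rewrite /f; case: ifP => // _; exact/ltW/weight_gt0.
(* The join of a configuration in [A] and one in [B] lies in both events, as they are increasing;
   the meet is left unconstrained. *)
have := @four_functions R (f A) (f B) (f (A `&` B)) (f setT) G tau tau' finG
  (f_ge0 A) (f_ge0 B) (f_ge0 _) (f_ge0 _).
have -> : (fun v => tau v || tau' v) = tau'.
  by apply/funext => v; have := tt' v; case: (tau v) => // ->.
have -> : (fun v => tau v && tau' v) = tau.
  by apply/funext => v; have := tt' v; case: (tau v) => // ->.
apply => sigma sigma' st s't'; rewrite {1 2}/f.
case: ifPn => [/set_mem As|_]; last by rewrite mul0r mulr_ge0.
case: ifPn => [/set_mem Bs|_]; last by rewrite mulr0 mulr_ge0.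
rewrite /f !mem_set//; first exact: (weight_lattice n_ge1 x_gt0 nx2_le1 finG tt').
by split; [apply: increasing_eventP As|apply: increasing_eventP Bs] => // v ->;
  rewrite ?orbT.
Qed.

End Measure.

Theorem theorem4 (R : realType) (n x : R) (n_ge1 : 1 <= n) (x_gt0 : 0 < x)
    (nx2_le1 : n * x ^+ 2 <= 1) (G : set vertex) (finG : finite_set G) :
  (forall (tau : config) (A B : set config),
     increasing_event A -> increasing_event B ->
     mu G n x tau (A `&` B) >= mu G n x tau A * mu G n x tau B)
  /\
  (forall (tau tau' : config) (A : set config),
     (tau <= tau')%O -> increasing_event A ->
     mu G n x tau A <= mu G n x tau' A).
Proof.
have Z_gt0 := mass_gt0 n_ge1 x_gt0 finG.
split=> [tau A B incA incB|tau tau' A /lefP tt' incA]; rewrite !muE.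
  rewrite mulrACA -invfM ler_pdivrMr ?mulr_gt0//.
  rewrite mulrA divfK ?gt_eqF//; exact: mass_mul_le.
rewrite ler_pdivrMr// mulrAC ler_pdivlMr//.
rewrite -{2}(setIT A); apply: mass_mul_le => // v.
by have := tt' v; case: (tau v) => //; case: (tau' v).
Qed.
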